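(* Let $\ell\ge 3$ and let $n\ge 2^{\ell-1}$ be integers. For every $A\in\mathbb{R}^{n\times n}$ and every linear map $L:\mathbb{R}^{n\times n}\to\mathbb{R}^\ell$, the set $L(O(A))=\{L(B):B\in O(A)\}$ is star-shaped with respect to the origin.
   Context: $\mathrm{SO}_n=\{U\in\mathbb{R}^{n\times n}:U^tU=UU^t=I_n,\ \det U>0\}$ is the set of $n\times n$ special orthogonal matrices. For $A\in\mathbb{R}^{n\times n}$, the special orthogonal orbit of $A$ is $O(A)=\{UAV:U,V\in\mathrm{SO}_n\}$. A set $S$ in a real vector space is star-shaped with respect to $c\in S$ if $\alpha x+(1-\alpha)c\in S$ for all $0\le\alpha\le 1$ and all $x\in S$ (in particular $c\in S$). *)

(* Defs.v *)
From HB Require Import structures.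
From mathcomp Require Import all_boot all_order all_algebra.
From mathcomp Require Import all_classical all_reals.

Set Implicit Arguments.
Unset Strict Implicit.
Unset Printing Implicit Defensive.

Import Order.TTheory GRing.Theory Num.Theory.

Local Open Scope classical_set_scope.
Local Open Scope ring_scope.

Definition special_orthogonal (R : realType) (n : nat) : set 'M[R]_n :=
  [set U | [/\ U^T *m U = 1%:M, U *m U^T = 1%:M & 0 < \det U]].

Definition so_orbit (R : realType) (n : nat) (A : 'M[R]_n) : set 'M[R]_n :=
  [set B | exists U V : 'M[R]_n,
     [/\ special_orthogonal U, special_orthogonal V & B = U *m A *m V]].

Definition star_shaped (R : realType) (E : lmodType R) (S : set E) (c : E) :
    Prop :=
  S c /\
  forall (a : R) (x : E), 0 <= a <= 1 -> S x -> S (a *: x + (1 - a) *: c).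

(* Main.v *)
Require Import Defs.
From HB Require Import structures.
From mathcomp Require Import all_boot all_order all_algebra.
From mathcomp Require Import all_classical all_reals.
From mathcomp Require Import fingroup perm ring lra.

Set Implicit Arguments.
Unset Strict Implicit.
Unset Printing Implicit Defensive.

Import Order.TTheory GRing.Theory Num.Theory.

Local Open Scope classical_set_scope.
Local Open Scope ring_scope.

(** The group SO_n contains round spheres that span large linear spaces, and a
    linear map that is not injective sends a round sphere onto a solid
    ellipsoid centred at the origin.

    Let J be a linear map from R^l to the skew-symmetric matrices of size N
    with J(x)^2 = - |x|^2 I.  The matrices a I + J(x) with a^2 + |x|^2 = 1
    then form an l-sphere inside SO_N around the origin, in a space of
    dimension l + 1.  A linear map from that space to R^l kills a line, and
    moving from alpha I along this line until the sphere is met produces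
    Q in SO_N with the same image as alpha I ([block_scalar_attained]).

    Such a J exists for N = 2^(l-1) as soon as l >= 3 ([clifford_pow2]): the
    imaginary quaternions do it for l = 3, and doubling the size of the
    matrices gains one dimension ([clifford_double]).  For l = 2 and N = 2 there
    is no such J, since the skew matrices of size 2 form a line.

    For n >= N, call M attained if every linear map to R^l takes at M a value
    that it also takes on SO_n.  The previous argument shrinks any N
    coordinates by a factor beta in [0, 1], and attained matrices are closed
    under products.  Doing this for the n cyclic windows of N consecutive
    coordinates multiplies each coordinate by beta^N, so alpha I is attained
    for every alpha in [0, 1] ([scalar_attained]).  Applied to X |-> L(X B),
    this says that alpha L(B) = L(W B) for some W in SO_n, which is the
    star-shapedness. *)

(** * Products and conjugates in the special orthogonal group *)

Section SpecialOrthogonal.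
Variables (R : realType) (n : nat).
Implicit Types (P U V Q : 'M[R]_n).

Lemma special_orthogonal1 : special_orthogonal (1%:M : 'M[R]_n).
Proof. by split; rewrite ?trmx1 ?mulmx1 // det1. Qed.

Lemma special_orthogonalM U V :
  special_orthogonal U -> special_orthogonal V -> special_orthogonal (U *m V).
Proof.
move=> [U1 U2 U3] [V1 V2 V3]; split.
- by rewrite trmx_mul mulmxA -(mulmxA V^T) U1 mulmx1.
- by rewrite trmx_mul mulmxA -(mulmxA U) V2 mulmx1.
- by rewrite det_mulmx mulr_gt0.
Qed.

Lemma special_orthogonal_conj P U :
  P *m P^T = 1%:M -> special_orthogonal U ->
  special_orthogonal (P *m U *m P^T).
Proof.
move=> PPt [U1 U2 U3]; have PtP := mulmx1C PPt; split.
- by rewrite !trmx_mul trmxK !mulmxA -(mulmxA (P *m U^T)) PtP mulmx1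
             -(mulmxA P) U1 mulmx1.
- by rewrite !trmx_mul trmxK !mulmxA -(mulmxA (P *m U)) PtP mulmx1
             -(mulmxA P) U2 mulmx1.
- by rewrite !det_mulmx mulrAC -det_mulmx PPt det1 mul1r.
Qed.

(** Since 1 + Q = Q (1 + Q)^T, the determinants of Q and 1 can only differ when
    -1 is an eigenvalue of Q. *)
Lemma orthogonal_det1 Q :
  Q *m Q^T = 1%:M -> \det (1%:M + Q) != 0 -> \det Q = 1.
Proof.
move=> QQt nz; apply: (mulIf nz); rewrite mul1r.
by rewrite -{1}(det_tr (1%:M + Q)) -det_mulmx linearD /= trmx1 mulmxDr mulmx1
           QQt addrC.
Qed.

End SpecialOrthogonal.

(** * Linear spaces of skew matrices with scalar squares *)

Section Clifford.
Variable R : realType.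

Definition sqnorm m (x : 'rV[R]_m) : R := \sum_i x 0 i ^+ 2.

Lemma sqnorm_gt0 m (x : 'rV[R]_m) : x != 0 -> 0 < sqnorm x.
Proof.
move=> x0; rewrite lt_def sumr_ge0 ?andbT => [|i _]; last exact: sqr_ge0.
apply: contra x0 => /eqP s0; apply/eqP/rowP => i; rewrite mxE.
apply/eqP; rewrite -sqrf_eq0; apply/eqP.
by apply: (psumr_eq0P _ s0) => // j _; exact: sqr_ge0.
Qed.

Definition clifford l m (J : 'rV[R]_l -> 'M[R]_m) : Prop :=
  [/\ linear J, forall x, (J x)^T = - J x
    & forall x, J x *m J x = (- sqnorm x)%:M].

Lemma sqnorm_split l (x : 'rV[R]_(1 + l)) :
  sqnorm x = x 0 0 ^+ 2 + sqnorm (rsubmx x).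
Proof.
rewrite /sqnorm big_split_ord /= big_ord1; congr (x _ _ ^+ 2 + _).
  exact/val_inj.
by apply: eq_bigr => i _; rewrite mxE.
Qed.

(** The block diagonal matrix with blocks J(x) and - J(x) anticommutes with
    the quarter turn that exchanges the two halves of the space, so a multiple
    of that turn can be added as a new coordinate. *)
Lemma clifford_double l m (J : 'rV[R]_l -> 'M[R]_m) : clifford J ->
  clifford (fun x : 'rV[R]_(1 + l) =>
    block_mx (J (rsubmx x)) (- x 0 0)%:M (x 0 0)%:M (- J (rsubmx x))).
Proof.
move=> [Jlin Jskew Jsq]; split=> [a x y|x|x].
- rewrite linearP Jlin /= scale_block_mx add_block_mx; congr block_mx.
  + by rewrite !mxE opprD -mulrN raddfD /= scale_scalar_mx.
  + by rewrite !mxE raddfD /= scale_scalar_mx.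
  + by rewrite opprD scalerN.
- rewrite tr_block_mx linearN /= !tr_scalar_mx Jskew opp_block_mx opprK.
  by rewrite !raddfN /= opprK.
- rewrite mulmx_block !mulNmx !mulmxN Jsq opprK -!scalar_mxM.
  rewrite !scalar_mxC !subrr.
  rewrite sqnorm_split [RHS]scalar_mx_block -!raddfD /=.
  by congr block_mx; congr _%:M; ring.
Qed.

(** Left multiplication by an imaginary quaternion. *)
Definition quaternion_mx (x : 'rV[R]_3) : 'M[R]_4 :=
  let b := x 0 0 in let c := x 0 1 in let d := x 0 2%:R in
  \matrix_(i, j) nth 0 (nth [::]
    [:: [:: 0; - b; - c; - d];
        [:: b; 0; - d; c];
        [:: c; d; 0; - b];
        [:: d; - c; b; 0]] i) j.

Lemma clifford_quaternion : clifford quaternion_mx.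
Proof.
split=> [a x y|x|x]; apply/matrixP=> i j.
- rewrite !mxE.
  by case: i => [[|[|[|[|?]]]] ?] //; case: j => [[|[|[|[|?]]]] ?] //=; ring.
- rewrite !mxE.
  by case: i => [[|[|[|[|?]]]] ?] //; case: j => [[|[|[|[|?]]]] ?] //=; ring.
- rewrite !mxE /sqnorm !big_ord_recl !big_ord0 !mxE.
  have -> : lift ord0 ord0 = 1 :> 'I_3 by exact/val_inj.
  have -> : lift ord0 (lift ord0 ord0) = 2%:R :> 'I_3 by exact/val_inj.
  by case: i => [[|[|[|[|?]]]] ?] //; case: j => [[|[|[|[|?]]]] ?] //=; ring.
Qed.

Lemma clifford_pow2 l : (3 <= l)%N ->
  exists J : 'rV[R]_l -> 'M[R]_(2 ^ (l - 1)), clifford J.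
Proof.
elim: l => // l IH; rewrite leq_eqVlt ltnS => /predU1P[[<-]|l3].
  by exists quaternion_mx; exact: clifford_quaternion.
have [J /clifford_double cJ] := IH l3.
have -> : (2 ^ (l.+1 - 1) = 2 ^ (l - 1) + 2 ^ (l - 1))%N.
  by rewrite addnn -mul2n -expnS -subSn // (leq_trans _ l3).
by eexists; exact: cJ.
Qed.

(** The kernel of T contains some k != 0.  As alpha e_0 lies in the unit ball,
    the half-lines that leave it in the directions k and - k both reach the
    unit sphere, and T is constant along them; the leading coordinate stays
    nonnegative on one of the two. *)
Lemma sphere_attains_contraction l (T : {linear 'rV[R]_(1 + l) -> 'rV[R]_l})
    (alpha : R) : 0 <= alpha <= 1 ->
  exists y : 'rV[R]_(1 + l), [/\ sqnorm y = 1, 0 <= y 0 0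
    & T y = alpha *: T (delta_mx 0 0)].
Proof.
move=> /andP[a0 a1].
have [k [k0 Tk kge0]] : exists k, [/\ k != 0, T k = 0 & 0 <= k 0 0].
  have /rowV0Pn[k /sub_kermxP] : kermx (lin1_mx T) != 0.
    by rewrite -mxrank_eq0 mxrank_ker subn_eq0 -ltnNge; exact: rank_leq_col.
  rewrite mul_rV_lin1 => Tk k0; have [kge0|/ltW kle0] := leP 0 (k 0 0).
    by exists k.
  by exists (- k); rewrite oppr_eq0 linearN Tk oppr0 mxE oppr_ge0.
have c0 := sqnorm_gt0 k0; set c := sqnorm k in c0.
pose D := (alpha * k 0 0) ^+ 2 + c * (1 - alpha ^+ 2).
have a2 : alpha ^+ 2 <= 1 by rewrite expr_le1.
have leD : (alpha * k 0 0) ^+ 2 <= D.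
  by rewrite lerDl mulr_ge0 ?subr_ge0 // ltW.
have D0 : 0 <= D := le_trans (sqr_ge0 _) leD.
(* s is the nonnegative root of |alpha e_0 + s k|^2 = 1. *)
pose s := (Num.sqrt D - alpha * k 0 0) / c.
have s0 : 0 <= s.
  rewrite divr_ge0 ?(ltW c0) // subr_ge0 -(@ger0_norm _ (alpha * k 0 0)).
    by rewrite -sqrtr_sqr ler_wsqrtr.
  exact: mulr_ge0.
exists (alpha *: delta_mx 0 0 + s *: k); split.
- rewrite sqnorm_split !mxE !eqxx mulr1.
  have -> : @rsubmx R 1 1 l (alpha *: delta_mx 0 0 + s *: k) =
      s *: @rsubmx R 1 1 l k.
    by apply/rowP => i; rewrite !mxE /= mulr0 add0r.
  have -> : sqnorm (s *: @rsubmx R 1 1 l k) = s ^+ 2 * (c - k 0 0 ^+ 2).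
    rewrite /c sqnorm_split addrC addKr /sqnorm mulr_sumr.
    by apply: eq_bigr => i _; rewrite !mxE exprMn.
  have cs : c * s = Num.sqrt D - alpha * k 0 0.
    by rewrite mulrC divfK // gt_eqF.
  have /eqP : (c * s + alpha * k 0 0) ^+ 2 = D by rewrite cs subrK sqr_sqrtr.
  rewrite /D -subr_eq0 => /eqP E; apply: (mulfI (lt0r_neq0 c0)).
  by apply/eqP; rewrite -subr_eq0; apply/eqP; rewrite -[RHS]E; ring.
- by rewrite !mxE !eqxx mulr1 addr_ge0 // mulr_ge0.
- by rewrite linearD !linearZ /= Tk scaler0 addr0.
Qed.

(** a I + J(x) is the analogue of a quaternion with real part a and imaginary
    part x: the product of Q = a I + J(x) with its conjugate Q^T is the scalar
    a^2 + |x|^2.  The same holds for 1 + Q, with a + 1 in place of a, so 1 + Q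
    is invertible, and this fixes the sign of det Q. *)
Lemma clifford_special_orthogonal l m (J : 'rV[R]_l -> 'M[R]_m) a x :
  clifford J -> a ^+ 2 + sqnorm x = 1 -> 0 <= a ->
  special_orthogonal (a%:M + J x).
Proof.
move=> [Jlin Jskew Jsq] ax1 a0.
have conjE b : (b%:M + J x) *m (b%:M + J x)^T = (b ^+ 2 + sqnorm x)%:M.
  rewrite linearD /= tr_scalar_mx Jskew mulmxBr !mulmxDl Jsq -scalar_mxM.
  by rewrite scalar_mxC opprD addrA addrK -raddfN -raddfD /= opprK.
have Qorth : (a%:M + J x) *m (a%:M + J x)^T = 1%:M by rewrite conjE ax1.
split=> //; first exact: mulmx1C.
rewrite (orthogonal_det1 Qorth) // addrA -raddfD /= -sqrf_eq0 expr2.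
rewrite -{2}det_tr -det_mulmx conjE det_scalar expf_eq0.
rewrite (_ : (1 + a) ^+ 2 + _ = 2 + 2 * a) ?(gt_eqF _) ?andbF //.
  by rewrite ltr_pwDl // mulr_ge0.
by move: ax1; lra.
Qed.

End Clifford.

(** * Matrices replaceable by special orthogonal ones *)

Section Attained.
Variables (R : realType) (l : nat).

Definition attained n (M : 'M[R]_n) : Prop :=
  forall L : {linear 'M[R]_n -> 'rV[R]_l},
    exists2 U, special_orthogonal U & L U = L M.

Lemma attained1 n : attained (1%:M : 'M[R]_n).
Proof. by move=> L; exists 1%:M => //; exact: special_orthogonal1. Qed.

Lemma attainedM n (M1 M2 : 'M[R]_n) :
  attained M1 -> attained M2 -> attained (M1 *m M2).
Proof.
move=> M1a M2a L.
have [U1 U1so /= E1] := M1a (L \o mulmxr M2).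
have [U2 U2so /= E2] := M2a (L \o mulmx U1).
by exists (U1 *m U2); [exact: special_orthogonalM | rewrite E2 E1].
Qed.

Lemma attained_conj n (P M : 'M[R]_n) :
  P *m P^T = 1%:M -> attained M -> attained (P *m M *m P^T).
Proof.
move=> PPt Ma L; have [U Uso /= E] := Ma (L \o mulmxr P^T \o mulmx P).
by exists (P *m U *m P^T); first exact: special_orthogonal_conj.
Qed.

Lemma special_orthogonal_block m r (Q : 'M[R]_m) :
  special_orthogonal Q ->
  special_orthogonal (block_mx Q 0 0 (1%:M : 'M[R]_r)).
Proof.
move=> [Q1 Q2 Q3].
split; rewrite ?det_ublock ?det1 ?mulr1 // tr_block_mx mulmx_block !trmx0 trmx1;
  by rewrite !(mul0mx, mulmx0, mulmx1, addr0, add0r) ?Q1 ?Q2 -scalar_mx_block.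
Qed.

(** On matrices with upper left block a I + J(x) and the other blocks fixed, L
    is an affine map of (a, x) in R^(1 + l), with values in R^l; its linear part
    takes the same value at b e_0 and at some point of the unit sphere. *)
Lemma block_scalar_attained m r (J : 'rV[R]_l -> 'M[R]_m) (b : R) :
  clifford J -> 0 <= b <= 1 ->
  attained (block_mx (b%:M : 'M[R]_m) 0 0 (1%:M : 'M[R]_r)).
Proof.
move=> cJ b01 L; have [Jlin _ _] := cJ.
pose F (y : 'rV[R]_(1 + l)) : 'M[R]_(m + r) :=
  block_mx ((y 0 0)%:M + J (rsubmx y)) 0 0 0.
have Flin : linear F.
  move=> t x y; rewrite /F scale_block_mx add_block_mx !scaler0 !addr0.
  congr block_mx; rewrite linearP Jlin !mxE raddfD /= scalerDr addrACA.
  by rewrite scale_scalar_mx.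
pose FL := GRing.isLinear.Build _ _ _ _ F Flin.
pose Fl : {linear _ -> _} := HB.pack F FL.
have [y [y1 y0 Ty]] := sphere_attains_contraction (L \o Fl) b01.
have {}Ty : L (F y) = b *: L (F (delta_mx 0 0)) := Ty.
have J0 : J 0 = 0.
  by have := Jlin (-1) 0 0; rewrite scaleN1r oppr0 addr0 scaleN1r addNr.
have splitE (X : 'M[R]_m) : block_mx X 0 0 (1%:M : 'M[R]_r) =
    block_mx X 0 0 0 + block_mx 0 0 0 1%:M.
  by rewrite add_block_mx !addr0 add0r.
exists (block_mx ((y 0 0)%:M + J (rsubmx y)) 0 0 1%:M).
  apply: special_orthogonal_block; apply: clifford_special_orthogonal => //.
  by rewrite -sqnorm_split.
rewrite (splitE (_ + _)) (splitE b%:M) !linearD; congr (_ + _).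
rewrite [LHS]Ty -linearZ; congr (L _).
rewrite /F scale_block_mx !scaler0 mxE !eqxx.
have -> : rsubmx (delta_mx 0 0 : 'rV[R]_(1 + l)) = 0.
  by apply/rowP => i; rewrite !mxE.
by rewrite J0 addr0 scale_scalar_mx mulr1.
Qed.

Lemma diag_perm_attained n (d : 'I_n -> R) (s : 'S_n) :
  attained (diag_mx (\row_i d i)) -> attained (diag_mx (\row_i d (s i))).
Proof.
move=> da; have -> : diag_mx (\row_i d (s i)) =
    perm_mx s *m diag_mx (\row_i d i) *m (perm_mx s)^T.
  rewrite tr_perm_mx -row_permE -col_permE; apply/matrixP => i j.
  by rewrite !mxE (inj_eq perm_inj).
by apply: attained_conj => //; rewrite tr_perm_mx -perm_mxM mulgV perm_mx1.
Qed.

(** Translates of d along the cyclic group of indices are again attained, and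
    their product has all its entries equal to the product of the entries
    of d. *)
Lemma scalar_prod_attained n (d : 'I_n -> R) :
  attained (diag_mx (\row_i d i)) -> attained ((\prod_i d i)%:M : 'M[R]_n).
Proof.
case: n d => [|n] d da.
  by rewrite big_ord0; exact: attained1.
suff prod_attained (r : seq 'I_n.+1) :
    attained (diag_mx (\row_i \prod_(k <- r) d (k + i))).
  have := prod_attained (index_enum 'I_n.+1); congr attained.
  rewrite -diag_const_mx; congr diag_mx; apply/rowP => i; rewrite !mxE.
  by rewrite [RHS](reindex_inj (addIr i)).
elim: r => [|k r IH].
  have -> : (\row_i \prod_(k <- [::]) d (k + i)) = const_mx 1.
    by apply/rowP => i; rewrite !mxE big_nil.
  by rewrite diag_const_mx; exact: attained1.
have := attainedM (diag_perm_attained (perm (addrI k)) da) IH.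
rewrite mulmx_diag; congr (attained (diag_mx _)); apply/rowP => i.
by rewrite !mxE permE big_cons.
Qed.

Lemma root_unit_interval m (a : R) : (0 < m)%N -> 0 <= a <= 1 ->
  exists2 b, 0 <= b <= 1 & b ^+ m = a.
Proof.
move=> m0 /andP[a0 a1].
have [|b b01] := @poly_ivt R ('X^m - a%:P) 0 1 ler01.
  by rewrite !hornerE expr0n expr1n eqn0Ngt m0 sub0r oppr_le0 a0 subr_ge0.
by rewrite rootE !hornerE subr_eq0 => /eqP E; exists b.
Qed.

Lemma scalar_attained n (a : R) :
  (3 <= l)%N -> (2 ^ (l - 1) <= n)%N -> 0 <= a <= 1 ->
  attained (a%:M : 'M[R]_n).
Proof.
move=> l3 le_n a01; have [J cJ] := clifford_pow2 R l3.
rewrite -(subnKC le_n); move: (n - _)%N => r.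
have [b b01 <-] : exists2 b, 0 <= b <= 1 & b ^+ (2 ^ (l - 1)) = a.
  by apply: root_unit_interval => //; rewrite expn_gt0.
pose d (i : 'I_(2 ^ (l - 1) + r)) := if fintype.split i is inl _ then b else 1.
have -> : b ^+ (2 ^ (l - 1)) = \prod_i d i.
  rewrite big_split_ord /= [X in _ * X]big1 ?mulr1 => [|i _].
    rewrite (eq_bigr (fun=> b)) ?prodr_const ?card_ord // => i _.
    by rewrite /d (unsplitK (inl i)).
  by rewrite /d (unsplitK (inr i)).
apply: scalar_prod_attained.
have := @block_scalar_attained _ r _ _ cJ b01; congr attained.
rewrite -!diag_const_mx -diag_mx_row; congr diag_mx; apply/rowP => i.
by rewrite mxE [RHS]mxE /d; case: (fintype.split i) => j; rewrite mxE.
Qed.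

End Attained.

Theorem theorem2p1 (R : realType) (l n : nat) (hl : (3 <= l)%N)
    (hn : (2 ^ (l - 1) <= n)%N) (A : 'M[R]_n)
    (L : {linear 'M[R]_n -> 'rV[R]_l}) :
  star_shaped (L @` so_orbit A) 0.
Proof.
have shrink a B : 0 <= a <= 1 -> so_orbit A B ->
    (L @` so_orbit A) (a *: L B).
  move=> a01 [U [V [Uso Vso BE]]].
  have [W Wso /= WE] := scalar_attained hl hn a01 (L \o mulmxr B).
  exists (W *m B); last by rewrite WE mul_scalar_mx linearZ.
  exists (W *m U), V; split => //; first exact: special_orthogonalM.
  by rewrite BE !mulmxA.
split.
  rewrite -(scale0r (L A)); apply: shrink; first by rewrite lexx ler01.
  exists 1%:M, 1%:M; split; try exact: special_orthogonal1.
  by rewrite mul1mx mulmx1.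
by move=> a _ a01 [B OB <-]; rewrite scaler0 addr0; exact: shrink.
Qed.
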